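(* For every $X\in L^\infty$ and every sub-$\sigma$-field $\mathcal{G}\subseteq\mathcal{F}$, the conditional expectation $\mathbb{E}[X\mid\mathcal{G}]$ is non-empty.
   Context: $\mathbb{K}$ is a local field with non-archimedean absolute value $|\cdot|$ satisfying $|x|=0 \iff x=0$, $|xy|=|x||y|$, $|x+y|\le|x|\vee|y|$. $(\Omega,\mathcal{F},\mathbb{P})$ is a probability space; all equalities/inequalities between random variables are a.s. $L^\infty$ is the space of $\mathbb{K}$-valued random variables $X$ with $\|X\|_\infty:=\operatorname{ess\,sup}|X|<\infty$; $L^\infty(\mathcal{G})$ is its subspace of $\mathcal{G}$-measurable elements. For a non-negative real random variable $S$, $\operatorname{ess\,sup}\{S\mid\mathcal{G}\}:=\sup_{p\ge1}\mathbb{E}[S^p\mid\mathcal{G}]^{1/p}$ (usual real conditional expectation), and $\|X\|_\mathcal{G}:=\operatorname{ess\,sup}\{|X|\mid\mathcal{G}\}$. The conditional expectation is the set $\mathbb{E}[X\mid\mathcal{G}]:=\{Y\in L^\infty(\mathcal{G}): \|X-Y\|_\mathcal{G}\le\|X-Z\|_\mathcal{G}\ \text{a.s. for all } Z\in L^\infty(\mathcal{G})\}$. *)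

(* Defs.v *)
From HB Require Import structures.
From mathcomp Require Import all_boot all_order all_algebra.
From mathcomp Require Import all_classical all_reals all_analysis.
Set Implicit Arguments. Unset Strict Implicit. Unset Printing Implicit Defensive.
Import Order.TTheory GRing.Theory Num.Theory.
Local Open Scope classical_set_scope.
Local Open Scope ring_scope.
Import numFieldNormedType.Exports.

Record nonarch_abs (K : fieldType) (R : realType) := NonarchAbs {
  nabs :> K -> R;
  nabs_ge0 : forall x, 0 <= nabs x;
  nabs_eq0 : forall x, nabs x = 0 <-> x = 0;
  nabsM : forall x y, nabs (x * y) = nabs x * nabs y;
  nabs_ultra : forall x y, nabs (x + y) <= Num.max (nabs x) (nabs y) }.

Definition kopen (K : fieldType) (R : realType) (a : nonarch_abs K R)
  (U : set K) : Prop :=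
  forall x, U x -> exists r : R, 0 < r /\ forall y, a (y - x) < r -> U y.

(** (K,|.|) is a local field: the absolute value is non-trivial (the topology
    is non-discrete) and K is locally compact (some closed ball around 0 is
    (sequentially, equivalently, since metric) compact). *)
Definition local_field (K : fieldType) (R : realType) (a : nonarch_abs K R) : Prop :=
  (exists x : K, 0 < a x < 1) /\
  exists r : R, 0 < r /\
    forall u : nat -> K, (forall n, a (u n) <= r) ->
      exists (phi : nat -> nat) (l : K),
        (forall n, (phi n < phi n.+1)%N) /\ a l <= r /\
        ((fun n => a (u (phi n) - l)) : R^nat) @ \oo --> (0 : R).

Definition sub_sigma_field d (T : measurableType d) (G : set (set T)) : Prop :=
  sigma_algebra setT G /\ G `<=` measurable.

(** K-valued X is G-measurable (Borel sigma-field of the metric topology). *)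
Definition Kmeasurable (K : fieldType) (R : realType) (a : nonarch_abs K R)
  d (T : measurableType d) (G : set (set T)) (X : T -> K) : Prop :=
  forall U, kopen a U -> G (X @^-1` U).

Definition Linf (K : fieldType) (R : realType) (a : nonarch_abs K R)
  d (T : measurableType d) (P : probability T R) (G : set (set T))
  (X : T -> K) : Prop :=
  Kmeasurable a G X /\ exists M : R, {ae P, forall w, a (X w) <= M}.

Definition is_cond_exp (R : realType) d (T : measurableType d)
  (P : probability T R) (G : set (set T)) (S Y : T -> R) : Prop :=
  (forall B : set R, measurable B -> G (Y @^-1` B)) /\
  P.-integrable setT (fun w => (Y w)%:E) /\
  forall A, G A -> (\int[P]_(w in A) (Y w)%:E = \int[P]_(w in A) (S w)%:E)%E.

(** A chosen version of E[S | G] (defined up to a.s. equality). *)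
Definition cond_exp (R : realType) d (T : measurableType d)
  (P : probability T R) (G : set (set T)) (S : T -> R) : T -> R :=
  xget (fun _ => 0) [set Y | is_cond_exp P G S Y].

Definition cond_esssup (R : realType) d (T : measurableType d)
  (P : probability T R) (G : set (set T)) (S : T -> R) : T -> \bar R :=
  fun w => ereal_sup [set (powR (cond_exp P G (fun v => S v ^+ p) w) (p%:R^-1))%:E
                     | p in [set p : nat | (1 <= p)%N]].

Definition normG (K : fieldType) (R : realType) (a : nonarch_abs K R)
  d (T : measurableType d) (P : probability T R) (G : set (set T))
  (X : T -> K) : T -> \bar R :=
  cond_esssup P G (fun w => a (X w)).

Definition in_cond_exp (K : fieldType) (R : realType) (a : nonarch_abs K R)
  d (T : measurableType d) (P : probability T R) (G : set (set T))
  (X Y : T -> K) : Prop :=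
  Linf a P G Y /\
  forall Z : T -> K, Linf a P G Z ->
    {ae P, forall w, (normG a P G (fun v => (X v - Y v)%R) w
                      <= normG a P G (fun v => (X v - Z v)%R) w)%E}.

(* Main.v *)
Require Import Defs.
From HB Require Import structures.
From mathcomp Require Import all_boot all_order all_algebra.
From mathcomp Require Import all_classical all_reals all_analysis.
From mathcomp Require Import measurable_realfun.
Set Implicit Arguments. Unset Strict Implicit. Unset Printing Implicit Defensive.
Import Order.TTheory GRing.Theory Num.Theory.
Import numFieldNormedType.Exports.
Local Open Scope classical_set_scope.
Local Open Scope ring_scope.

(* If Y(w) lies in the support of the conditional law of X given G, then by the
   ultrametric inequality every ball centred at a G-measurable Z that contains X
   also contains Y, hence |X - Y| <= q on every G-event where |X - Z| <= q; as
   the conditional norm is the least G-measurable upper bound, Y is optimal.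
   Such a Y is obtained without regular conditional laws: at scale 2^-n, pick the
   first point of a countable dense subset of K whose 2^-n-ball, intersected with
   the balls chosen so far, X visits with positive conditional probability, and
   let n tend to infinity. *)

(** * Existence of real conditional expectations *)

Section cond_exp_existence.
Context (R : realType) d (T : measurableType d) (P : probability T R).
Variables (G : set (set T)) (hG : sub_sigma_field G).

Let TG := g_sigma_algebraType G.

Let measurableG (A : set T) : (measurable : set (set TG)) A = G A.
Proof. by rewrite measurable_g_measurableTypeE//; case: hG. Qed.

(** [TG] is [T] with [G] as its measurable sets; pushing [P] forward along this identity restricts
    [P] to [G]. *)
Let idG : T -> TG := id.

Let measurable_idG : measurable_fun setT idG.
Proof.
by move=> _ A; rewrite setTI measurableG; exact: (proj2 hG).
Qed.

HB.instance Definition _ := isMeasurableFun.Build _ _ _ _ idG measurable_idG.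

Let PG : probability TG R := distribution P idG.

Variable (f : T -> R) (intf : P.-integrable setT (EFin \o f)).

(** Radon-Nikodym on [TG]: the charge sending [A] to the integral of [f] over [A] is dominated by
    the restriction of [P] to [G], and its density is the required version. *)
Lemma is_cond_exp_exists : exists Y, is_cond_exp P G f Y.
Proof.
pose nu_of := (pushforward (induced_charge intf) idG : {charge set TG -> \bar R}).
pose nu := nu_of measurable_idG.
have int0 (B : set T) : G B -> P B = 0 -> (\int[P]_(t in B) (f t)%:E = 0)%E.
  move=> /(proj2 hG) mB PB0.
  have mf := measurable_funS measurableT (@subsetT _ B) (measurable_int P intf).
  apply/eqP; rewrite -abse_eq0 eq_le abse_ge0 andbT.
  by rewrite -(integral_abs_eq0 mB mf PB0); exact: le_abse_integral.
have nuP : nu `<< PG.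
  apply/null_content_dominatesP => A mA PA0.
  by apply: int0 => //; rewrite -measurableG.
have [Y [Yfin Yint YE]] : exists Y : TG -> \bar R,
    [/\ (forall x, Y x \is a fin_num), PG.-integrable setT Y &
    forall A, measurable A -> nu A = (\int[PG]_(x in A) Y x)%E].
  exists (Radon_Nikodym nu PG); split.
  - by move=> x; exact: Radon_Nikodym_fin_num.
  - exact: Radon_Nikodym_integrable.
  - by move=> A mA; exact: Radon_Nikodym_integral.
have mY := measurable_int _ Yint.
have YfK : (fun w => (fine (Y w))%:E) = Y.
  by apply/funext => w; rewrite fineK.
have Yint' : P.-integrable setT (Y \o idG).
  apply/integrableP; split; first exact: measurableT_comp.
  move/integrableP : Yint => [_].
  rewrite ge0_integral_pushforward ?preimage_setT//=.
  exact: measurableT_comp.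
exists (fine \o Y); split.
- move=> B mB; rewrite -measurableG.
  have : measurable_fun setT (fine \o Y) by exact: measurableT_comp.
  by move=> /(_ measurableT _ mB); rewrite setTI.
- split; first by rewrite YfK.
  move=> A GA; rewrite YfK.
  have mA : (measurable : set (set TG)) A by rewrite measurableG.
  have := YE _ mA; rewrite integral_pushforward//.
  by apply: integrableS Yint' => //; apply: (proj2 hG).
Qed.

Lemma is_cond_expP : is_cond_exp P G f (cond_exp P G f).
Proof.
exact: (@xgetPex _ (fun=> 0) [set Y | is_cond_exp P G f Y] is_cond_exp_exists).
Qed.

End cond_exp_existence.

(** * Passing between bounds on p-th roots and bounds on p-th powers *)

Lemma powR_invn_leX (R : realType) (p : nat) (q y : R) : (0 < p)%N -> 0 <= q ->
  powR y p%:R^-1 <= q -> y <= q ^+ p.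
Proof.
move=> p0 q0 yq; have [y0|y0] := leP y 0; first exact: le_trans (exprn_ge0 _ _).
rewrite (_ : y = powR y p%:R^-1 ^+ p).
  by rewrite lerXn2r// nnegrE powR_ge0.
by rewrite -powR_mulrn ?powR_ge0// -powRrM mulVf ?pnatr_eq0 -?lt0n// powRr1// ltW.
Qed.

Lemma leX_powR_invn (R : realType) (p : nat) (q y : R) : (0 < p)%N -> 0 <= q ->
  0 <= y -> y <= q ^+ p -> powR y p%:R^-1 <= q.
Proof.
move=> p0 q0 y0 yq.
rewrite [leRHS](_ : q = powR (q ^+ p) p%:R^-1); last first.
  by rewrite -powR_mulrn// -powRrM mulfV ?pnatr_eq0 -?lt0n// powRr1.
by apply: ge0_ler_powR; rewrite ?invr_ge0 ?nnegrE ?exprn_ge0.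
Qed.

(** * Closure properties of sigma-algebras given as sets of sets *)

Section sigma_algebra_closure.
Context (T : Type) (G : set (set T)) (sG : sigma_algebra setT G).

Lemma sigma_algebra_setC A : G A -> G (~` A).
Proof. by case: sG => _ GD _ /GD; rewrite setTD. Qed.

Lemma sigma_algebra_setT : G setT.
Proof. by case: (sG) => G0 _ _; rewrite -setC0; exact: sigma_algebra_setC. Qed.

Lemma sigma_algebra_bigcupT (F : (set T)^nat) :
  (forall n, G (F n)) -> G (\bigcup_n F n).
Proof. by case: sG => _ _; exact. Qed.

Lemma sigma_algebra_bigcapT (F : (set T)^nat) :
  (forall n, G (F n)) -> G (\bigcap_n F n).
Proof.
move=> GF; rewrite -[X in G X]setCK setC_bigcap; apply: sigma_algebra_setC.
by apply: sigma_algebra_bigcupT => n; exact: sigma_algebra_setC.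
Qed.

Lemma sigma_algebra_setI A B : G A -> G B -> G (A `&` B).
Proof.
move=> GA GB; have -> : A `&` B = \bigcap_n (if n is 0%N then A else B).
  apply/seteqP; split => [x [Ax Bx] [|n] _//|x ABx].
  by split; [exact: (ABx 0%N)|exact: (ABx 1%N)].
by apply: sigma_algebra_bigcapT => -[|n].
Qed.

Lemma sigma_algebra_setU A B : G A -> G B -> G (A `|` B).
Proof.
move=> GA GB; rewrite -[X in G X]setCK setCU; apply: sigma_algebra_setC.
by apply: sigma_algebra_setI; exact: sigma_algebra_setC.
Qed.

Lemma sigma_algebra_cst (Q : Prop) : G [set _ | Q].
Proof.
have [q|nq] := pselect Q.
  rewrite (_ : mkset _ = setT); first exact: sigma_algebra_setT.
  by apply/seteqP; split.
rewrite (_ : mkset _ = set0); first by case: sG.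
by apply/seteqP; split.
Qed.

End sigma_algebra_closure.

(** * Bounds on conditional expectations *)

Section cond_exp_comparison.
Context (R : realType) d (T : measurableType d) (P : probability T R).
Variables (G : set (set T)) (hG : sub_sigma_field G).

Let sG := proj1 hG.
Let GM := proj2 hG.

(** Since [g] is positive on [B], its integral is that of [|g|]; being nonpositive, it vanishes, so
    [g] is a.e. zero on [B]. *)
Lemma integral_le0_gt0_null (g : T -> R) B : measurable B ->
  P.-integrable B (EFin \o g) -> (forall w, B w -> 0 < g w) ->
  (\int[P]_(w in B) (g w)%:E <= 0)%E -> P B = 0.
Proof.
move=> mB intg g0 gle0.
have mg := measurable_int _ intg.
have : (\int[P]_(w in B) `|(EFin \o g) w| = 0)%E.
  apply/eqP; rewrite eq_le integral_ge0// andbT; apply: le_trans gle0.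
  rewrite le_eqVlt; apply/orP; left; apply/eqP; apply: eq_integral => w.
  by rewrite inE => Bw; rewrite gee0_abs//= lee_fin ltW// g0.
move/(ae_eq_integral_abs P mB mg) => -[N [mN N0 BN]].
apply/eqP; rewrite -measure_le0 -N0 le_measure ?inE// => w Bw; apply: BN => /=.
by move=> /(_ Bw) [gw0]; have := g0 _ Bw; rewrite gw0 ltxx.
Qed.

Lemma ae_setP (A : set T) (Q : T -> Prop) :
  P (A `&` [set w | ~ Q w]) = 0 -> measurable (A `&` [set w | ~ Q w]) ->
  {ae P, forall w, A w -> Q w}.
Proof.
move=> P0 mA; exists (A `&` [set w | ~ Q w]); split => // w /=.
by move=> /not_implyP.
Qed.

Variables (f Y : T -> R) (intf : P.-integrable setT (EFin \o f)).
Hypothesis fY : is_cond_exp P G f Y.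

Let GY (B : set R) : measurable B -> G (Y @^-1` B).
Proof. by case: fY => H _; exact: H. Qed.

(** On the [G]-event [B] where [A] holds and [Y > c], the integral of [Y - c] equals that of
    [f - c], which is nonpositive; hence [B] is null. *)
Lemma is_cond_exp_le (c : R) A : G A -> {ae P, forall w, A w -> f w <= c} ->
  {ae P, forall w, A w -> Y w <= c}.
Proof.
move=> GA fc; case: fY => _ [intY YE].
pose B := A `&` Y @^-1` `]c, +oo[%classic.
have GB : G B by apply: sigma_algebra_setI => //; exact: GY.
have mB := GM GB.
have BE : B = A `&` [set w | ~ Y w <= c].
  apply/seteqP; split => w [Aw] /=; first by rewrite in_itv/= andbT ltNge => /negP.
  by move=> /negP; rewrite -ltNge => cY; split => //=; rewrite in_itv/= andbT.
apply: ae_setP; rewrite -BE//.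
have intB (g : T -> R) : P.-integrable setT (EFin \o g) ->
    P.-integrable B (EFin \o g).
  by apply: integrableS.
have intc : P.-integrable B (EFin \o cst c).
  exact: finite_measure_integrable_cst.
apply: (@integral_le0_gt0_null (fun w => Y w - c)) => //.
- exact: (integrableB mB (intB _ intY) intc).
- by move=> w [_]; rewrite /= in_itv/= andbT subr_gt0.
- have -> : (\int[P]_(w in B) (Y w - c)%:E =
             \int[P]_(w in B) (Y w)%:E - \int[P]_(w in B) (cst c w)%:E)%E.
    by rewrite -(integralB mB (intB _ intY) intc).
  (* The bound on [f] may fail on the null set [N]; both integrals are restricted to the complement
     of [N] in [B], where it holds pointwise. *)
  case: fc => N [mN N0 fcN].
  rewrite YE// sube_le0 (negligible_integral mN mB (intB _ intf) N0).
  rewrite [leRHS](negligible_integral mN mB intc N0).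
  have mBN := measurableD mB mN.
  have BNB : B `\` N `<=` B by move=> w [].
  apply: le_integral => //.
  + exact: integrableS (intB _ intf).
  + exact: integrableS intc.
  + move=> w; rewrite inE => -[[Aw _] Nw]; rewrite lee_fin.
    by apply: contrapT => fw; apply: Nw; apply: fcN => /(_ Aw).
Qed.

Lemma is_cond_exp_ge0 : (forall w, 0 <= f w) -> {ae P, forall w, 0 <= Y w}.
Proof.
move=> f0; case: fY => _ [intY YE].
pose B := Y @^-1` `]-oo, 0[%classic.
have GB : G B by exact: GY.
have mB := GM GB.
suff PB : P B = 0.
  by exists B; split => // w /= /negP; rewrite -ltNge => Yw; rewrite /B/= in_itv.
apply: (@integral_le0_gt0_null (fun w => - Y w)) => //.
- have := integrableS measurableT mB (@subsetT _ B) intY.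
  exact: integrableN.
- by move=> w; rewrite /B /= in_itv/= oppr_gt0.
- have -> : (\int[P]_(w in B) (- Y w)%:E = - \int[P]_(w in B) (Y w)%:E)%E.
    rewrite -integralN//; apply: integrable_add_def => //.
    exact: integrableS intY.
  by rewrite YE// oppe_le0 integral_ge0// => w _; rewrite lee_fin.
Qed.

End cond_exp_comparison.

(** * Events of positive conditional probability *)

Section conditional_hull.
Context (R : realType) d (T : measurableType d) (P : probability T R).
Variables (G : set (set T)) (hG : sub_sigma_field G).

(* [H] is the event that the conditional probability of [C] is positive. *)
Lemma conditional_hull (C : set T) : measurable C -> exists H, [/\ G H,
  (forall A, G A -> A `<=` ~` H -> P (A `&` C) = 0) &
  (forall A, G A -> A `<=` H -> P (A `&` C) = 0 -> P A = 0)].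
Proof.
case: (hG) => sG GM mC.
have intC := integrable_indic P mC.
have [Y [GY [intY YE]]] := is_cond_exp_exists hG intC.
have intE A : measurable A -> (\int[P]_(w in A) (\1_C w)%:E = P (A `&` C))%E.
  by move=> mA; rewrite integral_indic// setIC.
exists (Y @^-1` `]0, +oo[%classic); split; first exact: GY.
(* [Y] is a version of the conditional probability of [C], so [P (A]&[C)] is the integral of [Y]
   over [A]: it is nonpositive off [H], and on [H] it vanishes only if [A] is null. *)
- move=> A GA AH; have mA := GM _ GA; rewrite -intE// -YE//.
  apply/eqP; rewrite eq_le; apply/andP; split; last first.
    by rewrite YE// intE// measure_ge0//; exact: measurableI.
  rewrite -[leRHS](@integral0 _ _ _ P A); apply: le_integral => //.
  + exact: integrableS intY.
  + exact: integrable0.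
  + move=> w; rewrite inE => /AH /=; rewrite in_itv/= andbT => /negP.
    by rewrite -leNgt lee_fin.
- move=> A GA AH AC0; have mA := GM _ GA.
  apply: (@integral_le0_gt0_null _ _ _ _ Y) => //.
  + exact: integrableS intY.
  + by move=> w /AH /=; rewrite in_itv/= andbT.
  + by rewrite YE// intE// AC0.
Qed.

End conditional_hull.

(** * The conditional essential supremum as least [G]-measurable upper bound *)

Section cond_esssup_theory.
Context (R : realType) d (T : measurableType d) (P : probability T R).
Variables (G : set (set T)) (hG : sub_sigma_field G).
Let sG := proj1 hG.
Let GM := proj2 hG.

Variable S : T -> R.
Hypotheses (S0 : forall w, 0 <= S w) (mS : measurable_fun setT S).
Hypothesis Sb : exists M, {ae P, forall w, S w <= M}.

Lemma integrableX_ae_bounded p : P.-integrable setT (EFin \o (fun w => S w ^+ p)).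
Proof.
have mSp : measurable_fun setT (EFin \o (fun w => S w ^+ p)).
  by apply/measurable_EFinP; exact: measurable_funX.
apply/integrableP; split => //.
case: Sb => M SM.
apply: le_lt_trans.
  (* The maximum with 0 makes the bound nonnegative, so that powers preserve the inequality. *)
  apply: (@integral_le_bound _ _ _ P setT _ (Num.max 0 M ^+ p)%:E) => //.
    by rewrite lee_fin exprn_ge0// le_max lexx.
  apply: filterS SM => w SM _ /=; rewrite lee_fin ger0_norm ?exprn_ge0//.
  by rewrite lerXn2r ?nnegrE// ?le_max ?lexx ?SM ?orbT.
apply: (@le_lt_trans _ _ ((Num.max 0 M ^+ p)%:E * 1)%E); last by rewrite mule1 ltry.
apply: lee_wpmul2l; last exact: probability_le1.
by rewrite lee_fin exprn_ge0// le_max lexx.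
Qed.

Let Y p := cond_exp P G (fun w => S w ^+ p).

Let YP p : is_cond_exp P G (fun w => S w ^+ p) (Y p).
Proof. exact/is_cond_expP/integrableX_ae_bounded. Qed.

Lemma cond_esssup_leP w (v : \bar R) : (cond_esssup P G S w <= v)%E <->
  forall p, (0 < p)%N -> ((powR (Y p w) p%:R^-1)%:E <= v)%E.
Proof.
split=> [Sv p p0|H].
  by apply: le_trans Sv; apply: ereal_sup_ubound; exists p.
by apply: ge_ereal_sup => _ [p p0 <-]; exact: H.
Qed.

Lemma cond_esssup_ge0 w : (0 <= cond_esssup P G S w)%E.
Proof.
apply: le_ereal_sup_tmp; exists (powR (Y 1 w) 1%:R^-1)%:E; first by exists 1%N.
by rewrite lee_fin powR_ge0.
Qed.

Lemma cond_esssup_measurable (q : R) : G [set w | (cond_esssup P G S w <= q%:E)%E].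
Proof.
(* A countable intersection of Borel conditions on the [Y p]; the shift to [p.+1] skips the exponent
   0. *)
have -> : [set w | (cond_esssup P G S w <= q%:E)%E] =
    \bigcap_p (Y p.+1 @^-1` ((fun y => powR y p.+1%:R^-1) @^-1` `]-oo, q]%classic)).
  apply/seteqP; split => w /=.
    by move=> /cond_esssup_leP wq p _ /=; rewrite in_itv/= -lee_fin wq.
  move=> wq; apply/cond_esssup_leP => -[//|p] _.
  by have := wq p I; rewrite /= in_itv/= lee_fin.
apply: sigma_algebra_bigcapT => // p; case: (YP p.+1) => + _; apply.
by rewrite -[X in measurable X]setTI; exact: measurable_powR.
Qed.

(* Chebyshev: for [q < q'], the event [S >= q'] within [cond_esssup S <= q] has
   probability at most [(q / q') ^+ p] for every [p]. *)
Lemma ae_le_cond_esssup (q : R) : 0 <= q ->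
  {ae P, forall w, (cond_esssup P G S w <= q%:E)%E -> S w <= q}.
Proof.
move=> q0; pose A := [set w | (cond_esssup P G S w <= q%:E)%E].
have GA : G A by exact: cond_esssup_measurable.
have mA := GM GA.
have mSge c : measurable [set w | c <= S w].
  have -> : [set w | c <= S w] = S @^-1` `[c, +oo[%classic.
    by apply/seteqP; split => w /=; rewrite in_itv/= andbT.
  by rewrite -[X in measurable X]setTI; exact: mS.
suff PA0 : forall n, P (A `&` [set w | q + n.+1%:R^-1 <= S w]) = 0.
  have : {ae P, forall w n, A w -> S w < q + n.+1%:R^-1}.
    apply: ae_foralln => n.
    exists (A `&` [set w | q + n.+1%:R^-1 <= S w]); split => //.
    - exact: measurableI.
    - exact: PA0.
    - by move=> w /= /not_implyP[Aw /negP]; rewrite -leNgt.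
  apply: filterS => w Sw Aw; apply/ler_addgt0Pr => e e0.
  have [n ne] : exists n, n.+1%:R^-1 < e.
    exists (Num.trunc e^-1); rewrite invf_plt ?posrE//.
    exact: truncnS_gt.
  by apply: ltW; apply: (lt_trans (Sw n Aw)); rewrite ltrD2l.
move=> n; set q' := q + n.+1%:R^-1.
have qq' : q < q' by rewrite ltrDl invr_gt0.
have q'0 : 0 < q' by exact: le_lt_trans qq'.
set B := A `&` _.
have mB : measurable B by apply: measurableI.
(* The chain is: [q' ^+ p * P B] is at most the integral of [S ^+ p] over [B], hence over [A]; there
   it equals the integral of [Y p], which is at most [q ^+ p]. *)
have key p : (0 < p)%N -> fine (P B) <= (q / q') ^+ p.
  move=> p0; rewrite expr_div_n ler_pdivlMr ?exprn_gt0//.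
  rewrite -lee_fin EFinM fineK ?fin_num_measure//.
  have intS := integrableX_ae_bounded p.
  case: (YP p) => _ [intY YE].
  apply: (@le_trans _ _ (\int[P]_(w in B) (S w ^+ p)%:E)%E).
    rewrite muleC -integral_cst//; apply: le_integral => //.
    - exact: finite_measure_integrable_cst.
    - exact: integrableS intS.
    - move=> w; rewrite inE => -[_ /= Sw]; rewrite lee_fin lerXn2r// nnegrE ltW//.
      exact: lt_le_trans Sw.
  apply: (@le_trans _ _ (\int[P]_(w in A) (S w ^+ p)%:E)%E).
    apply: ge0_subset_integral => //.
    - apply/measurable_EFinP; apply: measurable_funX.
      exact: measurable_funTS.
    - by move=> w _; rewrite lee_fin exprn_ge0.
    - by move=> w [].
  rewrite -YE//; apply: (@le_trans _ _ (\int[P]_(w in A) (cst (q ^+ p) w)%:E)%E).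
    apply: le_integral => //.
    - exact: integrableS intY.
    - exact: finite_measure_integrable_cst.
    - move=> w; rewrite inE => /cond_esssup_leP /(_ p p0); rewrite !lee_fin.
      exact: powR_invn_leX.
  rewrite [leLHS](integral_cst P mA (q ^+ p)%:E) -[leRHS]mule1.
  by apply: lee_wpmul2l; [rewrite lee_fin exprn_ge0|exact: probability_le1].
have PB : fine (P B) <= 0.
  rewrite leNgt; apply/negP => PB0.
  have z1 : `|q / q'| < 1.
    by rewrite ger0_norm ?divr_ge0// 1?ltW// ltr_pdivrMr// mul1r.
  have /cvgr0_norm_lt /(_ _ PB0) [N _ HN] := cvg_expr z1.
  (* [N.+1] rather than [N], because [key] requires a positive exponent. *)
  have := HN N.+1 (leqnSn N); rewrite /= ger0_norm; last first.
    by rewrite exprn_ge0// divr_ge0// ltW.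
  by rewrite ltNge key.
have PB' : (P B <= 0)%E by rewrite -(fineK (fin_num_measure P B mB)) lee_fin.
by apply/eqP; rewrite eq_le PB' measure_ge0.
Qed.

(** Minimality. On the [G]-event [V <= q] one has [S ^+ p <= q ^+ p] a.s., so the conditional
    expectation of [S ^+ p] obeys the same bound; letting [q] run over the positive rationals
    compares its p-th root with [V]. *)
Lemma cond_esssup_ae_le (V : T -> \bar R) : (forall w, 0 <= V w)%E ->
  (forall q : R, 0 < q -> G [set w | (V w <= q%:E)%E]) ->
  (forall q : R, 0 < q -> {ae P, forall w, (V w <= q%:E)%E -> S w <= q}) ->
  {ae P, forall w, (cond_esssup P G S w <= V w)%E}.
Proof.
move=> V0 GV VS.
have H (p : nat) : {ae P, forall w, (0 < p)%N -> ((powR (Y p w) p%:R^-1)%:E <= V w)%E}.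
  (* Rationals are indexed by their codes, so that the exceptional sets form a countable family. *)
  have Yq (n : nat) : {ae P, forall w, forall q : rat, unpickle n = Some q -> 0 < q ->
      (V w <= (ratr q : R)%:E)%E -> Y p w <= ratr q ^+ p}.
    case: (unpickle n) => [q|]; last by apply: aeW.
    have [q0|q0] := ltP 0 q; last by apply: aeW => w _ [<-]; rewrite ltNge q0.
    have q0' : 0 < ratr q :> R by rewrite ltr0q.
    have : {ae P, forall w, [set w | (V w <= (ratr q : R)%:E)%E] w ->
        Y p w <= ratr q ^+ p}.
      apply: (is_cond_exp_le hG (integrableX_ae_bounded p) (YP p) (GV _ q0')).
      apply: filterS (VS _ q0') => w /= H Vw.
      by rewrite lerXn2r ?nnegrE ?H// ltW.
    by apply: filterS => w /= H _ [<-].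
  have Y0 : {ae P, forall w, 0 <= Y p w}.
    by apply: is_cond_exp_ge0 (YP p) _ => // w; exact: exprn_ge0.
  apply: filterS2 Y0 (ae_foralln Yq) => w Y0 Yq' p0.
  case: (V w) (V0 w) Yq' => [v|_ _|//]; last by rewrite leey.
  rewrite !lee_fin => v0 Yq'; rewrite leNgt; apply/negP => /rat_in_itvoo[q].
  rewrite in_itv/= => /andP[vq]; apply/negP; rewrite -leNgt.
  have q0 : 0 < ratr q :> R by exact: le_lt_trans vq.
  apply: leX_powR_invn => //; first exact: ltW.
  apply: (Yq' (pickle q)); rewrite ?pickleK//; first by rewrite -(ltr0q R).
  by rewrite lee_fin ltW.
apply: filterS (ae_foralln H) => w Hw.
by apply/cond_esssup_leP.
Qed.

End cond_esssup_theory.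

Lemma exists_half_expn_lt (R : realType) (e : R) : 0 < e -> exists n : nat, 2^-1 ^+ n < e.
Proof.
move=> e0; have h1 : `|2^-1 : R| < 1 by rewrite ger0_norm// invf_lt1// ltr1n.
have /cvgr0_norm_lt /(_ _ e0) [N _ /(_ N (leqnn N))] := cvg_expr h1.
by rewrite /= ger0_norm// => ?; exists N.
Qed.

Lemma increasing_geq_id (phi : nat -> nat) n :
  (forall n, (phi n < phi n.+1)%N) -> (n <= phi n)%N.
Proof. by move=> H; elim: n => // n IH; exact: leq_ltn_trans (H n). Qed.

(** * Ultrametric calculus *)

Section nonarch_abs_theory.
Context (K : fieldType) (R : realType) (a : nonarch_abs K R).

Lemma nabs0 : a 0 = 0.
Proof. exact/nabs_eq0. Qed.

Lemma nabs_gt0 x : x != 0 -> 0 < a x.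
Proof.
by move=> x0; rewrite lt_neqAle nabs_ge0 andbT eq_sym; apply: contra_neq x0 => /nabs_eq0.
Qed.

Lemma nabs1 : a 1 = 1.
Proof.
apply: (@mulfI _ (a 1)); first by rewrite gt_eqF// nabs_gt0// oner_eq0.
by rewrite -nabsM !mulr1.
Qed.

Lemma nabsN x : a (- x) = a x.
Proof.
suff aN1 : a (-1) = 1 by rewrite -mulN1r nabsM aN1 mul1r.
have /eqP : a (-1) ^+ 2 = 1 by rewrite expr2 -nabsM mulrNN mulr1 nabs1.
rewrite sqrf_eq1 => /orP[/eqP//|/eqP aN]; have := nabs_ge0 a (-1).
by rewrite aN oppr_ge0 ler10.
Qed.

Lemma nabsC x y : a (x - y) = a (y - x).
Proof. by rewrite -nabsN opprB. Qed.

Lemma nabsX x n : a (x ^+ n) = a x ^+ n.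
Proof. by elim: n => [|n IH]; rewrite ?expr0 ?nabs1// !exprS nabsM IH. Qed.

Lemma nabs_lt_trans y x z r : a (x - y) < r -> a (y - z) < r -> a (x - z) < r.
Proof.
move=> xy yz; rewrite (_ : x - z = (x - y) + (y - z)); last by rewrite addrA subrK.
by apply: le_lt_trans (nabs_ultra _ _ _) _; rewrite gt_max xy yz.
Qed.

Lemma nabs_le_trans y x z r : a (x - y) <= r -> a (y - z) <= r -> a (x - z) <= r.
Proof.
move=> xy yz; rewrite (_ : x - z = (x - y) + (y - z)); last by rewrite addrA subrK.
by apply: le_trans (nabs_ultra _ _ _) _; rewrite ge_max xy yz.
Qed.

Lemma kopen_lt c r : kopen a [set x | a (x - c) < r].
Proof.
move=> x /= xr; exists r; split; first exact: le_lt_trans (nabs_ge0 _ _) xr.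
by move=> y yx; exact: nabs_lt_trans xr.
Qed.

(** By the ultrametric inequality, a closed ball of positive radius contains the open ball of the
    same radius around each of its points. *)
Lemma kopen_le c r : 0 < r -> kopen a [set x | a (x - c) <= r].
Proof.
move=> r0 x /= xr; exists r; split => // y /ltW yx; exact: nabs_le_trans xr.
Qed.

End nonarch_abs_theory.

(** * Completeness and separability of local fields *)

Section local_field_topology.
Context (K : fieldType) (R : realType) (a : nonarch_abs K R).
Hypothesis hK : local_field a.

(** A tail of [u], translated by [u N], stays in the compact ball; a subsequential limit there,
    translated back, is the limit. *)
Lemma local_field_complete (u : nat -> K) :
  (forall n, a (u n.+1 - u n) < 2^-1 ^+ n) ->
  exists l, forall n, a (l - u n) < 2^-1 ^+ n.
Proof.
move=> uC.
(* The ultrametric inequality bounds a sum of steps by the largest one, so no geometric series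
   appears. *)
have uD n k : a (u (n + k)%N - u n) < 2^-1 ^+ n.
  elim: k => [|k IH]; first by rewrite addn0 subrr nabs0 exprn_gt0.
  rewrite addnS; apply: nabs_lt_trans IH; apply: lt_le_trans (uC _) _.
  by rewrite ler_wiXn2l ?leq_addr// invf_le1// ler1n.
case: hK => _ [r [r0 hr]].
have [N Nr] := exists_half_expn_lt r0.
have [k|phi [l [phiS [_ cvl]]]] := hr (fun k => u (N + k)%N - u N).
  exact/ltW/(lt_trans (uD _ _)).
exists (l + u N) => n.
have /cvgr0_norm_lt /(_ _ (@exprn_gt0 _ n (2^-1 : R) _)) [|M _ HM] := cvl => //.
(* The index [maxn M n] passes the convergence threshold and also gives [n <= N + m], so that [uD]
   compares [u (N + m)] with [u n]. *)
have := HM (maxn M n) (leq_maxl _ _).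
set m := phi _ => /=; rewrite ger0_norm ?nabs_ge0// => ml.
have nm : (n <= N + m)%N.
  apply: leq_trans (leq_addl _ _); apply: leq_trans (increasing_geq_id _ phiS).
  exact: leq_maxr.
apply: (@nabs_lt_trans _ _ _ (u (N + m)%N)).
  by rewrite nabsC opprD addrA addrAC.
by rewrite -(subnKC nm).
Qed.

(** The compact ball has finite nets at every scale, and multiplying them by negative powers of an
    element [pi] with [0 < a pi < 1] reaches all of [K]. *)
Lemma local_field_separable : exists D : nat -> K,
  forall x e, 0 < e -> exists i, a (x - D i) < e.
Proof.
case: (hK) => -[pi /andP[pi0 pi1]] [r [r0 hr]].
have net e : 0 < e -> exists s : seq K,
    forall x, a x <= r -> exists2 y, y \in s & a (x - y) < e.
  (* Without a finite net, [F] picks a point of the ball at distance at least [e] from any finite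
     list; iterating it yields an [e]-separated sequence, against compactness. *)
  move=> e0; apply: contrapT => /forallNP noNet.
  have /choice[F HF] : forall s : seq K, exists x,
      a x <= r /\ forall y, y \in s -> e <= a (x - y).
    move=> s; have /existsNP[x /not_implyP[xr xs]] := noNet s.
    exists x; split => // y ys; rewrite leNgt; apply/negP => xy.
    by apply: xs; exists y.
  pose s n := iter n (fun s => F s :: s) [::].
  have sin m n : (m < n)%N -> F (s m) \in s n.
    elim: n => // n IH; rewrite ltnS leq_eqVlt => /orP[/eqP->|/IH mn].
      by rewrite /= mem_head.
    by rewrite /= in_cons mn orbT.
  have [n|phi [l [phiS [_ cvl]]]] := hr (fun n => F (s n)).
    by have [] := HF (s n).
  have /cvgr0_norm_lt /(_ _ e0) [M _ HM] := cvl.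
  have := HM M.+1 (leqnSn M); have := HM M (leqnn M).
  rewrite /= !ger0_norm ?nabs_ge0// => h1 h2.
  have := (HF (s (phi M.+1))).2 _ (sin _ _ (phiS M)).
  by rewrite leNgt (@nabs_lt_trans _ _ _ l)// nabsC.
have /choice[N HN] : forall n : nat, exists s : seq K, forall x, a x <= r ->
    exists2 y, y \in s & a (x - y) < 2^-1 ^+ n.
  by move=> n; apply: net; rewrite exprn_gt0.
pose D i := if unpickle i is Some (m, n, k) then pi ^- m * nth 0 (N n) k else 0.
have pin0 : pi != 0 by apply: contraTneq pi0 => ->; rewrite nabs0 ltxx.
exists D => x e e0.
have [m xm] : exists m, a (pi ^+ m * x) <= r.
  have h1 : `|a pi| < 1 by rewrite ger0_norm// nabs_ge0.
  have x1 : 0 < a x + 1 by rewrite ltr_wpDl// nabs_ge0.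
  have /cvgr0_norm_lt /(_ _ (divr_gt0 r0 x1)) [M _ /(_ M (leqnn M))] := cvg_expr h1.
  rewrite /= ger0_norm ?exprn_ge0 ?nabs_ge0// ltr_pdivlMr// => Mr.
  exists M; rewrite nabsM nabsX; apply: le_trans (ltW Mr).
  by rewrite ler_wpM2l ?exprn_ge0 ?nabs_ge0// lerDl.
have pim0 : 0 < a pi ^+ m by rewrite exprn_gt0.
(* Dividing by [pi ^+ m] magnifies distances, so the net must have precision [e * a pi ^+ m]. *)
have [n ne] := exists_half_expn_lt (mulr_gt0 e0 pim0).
have [y yN yx] := HN n _ xm.
exists (pickle (m, n, index y (N n))).
rewrite /D pickleK nth_index// -(ltr_pM2r pim0) -nabsX -nabsM mulrBl.
rewrite [pi ^- m * y]mulrC mulfVK ?expf_neq0// [x * _]mulrC.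
by apply: lt_trans yx _; rewrite nabsX.
Qed.

End local_field_topology.

(** * Measurability of distances between [K]-valued maps *)

Section Kmeasurable_theory.
Context (K : fieldType) (R : realType) (a : nonarch_abs K R) (hK : local_field a).
Context d (T : measurableType d) (G : set (set T)) (sG : sigma_algebra setT G).

(** Two points are closer than [r] exactly when one ball of radius [r] around a point of the dense
    sequence contains both, which gives a countable union. *)
Lemma Kmeasurable_nabs_lt (X Y : T -> K) r :
  Kmeasurable a G X -> Kmeasurable a G Y -> G [set w | a (X w - Y w) < r].
Proof.
move=> GX GY; have [D HD] := local_field_separable hK.
have [r0|r0] := ltP 0 r; last first.
  rewrite (_ : mkset _ = set0); first by case: sG.
  by apply/seteqP; split => // w /=; rewrite ltNge (le_trans r0)// nabs_ge0.
have -> : [set w | a (X w - Y w) < r] = \bigcup_i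
    (X @^-1` [set x | a (x - D i) < r] `&` Y @^-1` [set x | a (x - D i) < r]).
  apply/seteqP; split => [w /= XY|w [i _ [/= Xi Yi]]]; last first.
    by apply: nabs_lt_trans Xi _; rewrite nabsC.
  have [i Xi] := HD (X w) _ r0.
  by exists i => //; split => //=; apply: nabs_lt_trans Xi; rewrite nabsC.
apply: sigma_algebra_bigcupT => // i; apply: sigma_algebra_setI => //.
  exact/GX/kopen_lt.
exact/GY/kopen_lt.
Qed.

Lemma Kmeasurable_nabs_le (X Y : T -> K) r : 0 < r ->
  Kmeasurable a G X -> Kmeasurable a G Y -> G [set w | a (X w - Y w) <= r].
Proof.
move=> r0 GX GY; have [D HD] := local_field_separable hK.
have -> : [set w | a (X w - Y w) <= r] = \bigcup_i
    (X @^-1` [set x | a (x - D i) <= r] `&` Y @^-1` [set x | a (x - D i) <= r]).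
  apply/seteqP; split => [w /= XY|w [i _ [/= Xi Yi]]]; last first.
    by apply: nabs_le_trans Xi _; rewrite nabsC.
  have [i /ltW Xi] := HD (X w) _ r0.
  by exists i => //; split => //=; apply: nabs_le_trans Xi; rewrite nabsC.
apply: sigma_algebra_bigcupT => // i; apply: sigma_algebra_setI => //.
  exact/GX/kopen_le.
exact/GY/kopen_le.
Qed.

End Kmeasurable_theory.

(* The conditional probability of [D] given [G] is almost surely positive. *)
Definition conditionally_full (R : realType) d (T : measurableType d)
    (P : probability T R) (G : set (set T)) (D : set T) : Prop :=
  forall A, G A -> P (A `&` D) = 0 -> P A = 0.

(** * Measurable selection from the conditional support *)

Section conditional_support.
Context (K : fieldType) (R : realType) (a : nonarch_abs K R) (hK : local_field a).
Context d (T : measurableType d) (P : probability T R).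
Variables (G : set (set T)) (hG : sub_sigma_field G).
Variables (X : T -> K) (mX : Kmeasurable a measurable X).
Let sG := proj1 hG.
Let GM := proj2 hG.
Let sM := sigma_algebra_measurable T.

Lemma Kmeasurable_sub_sigma_field (Y : T -> K) :
  Kmeasurable a G Y -> Kmeasurable a measurable Y.
Proof. by move=> GY U /GY /GM. Qed.

Lemma null_subset (A B : set T) : measurable A -> measurable B ->
  A `<=` B -> P B = 0 -> P A = 0.
Proof.
move=> mA mB AB PB; apply: measure_negligible => //.
by exists B; split.
Qed.

(** One scale of the selection: [Y] is the first [x i] whose [r]-ball is visited by [X] within [D]
    with positive conditional probability. *)
Lemma conditional_support_step (D : set T) r : measurable D ->
  conditionally_full P G D -> 0 < r ->
  exists Y, Kmeasurable a G Y /\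
    conditionally_full P G (D `&` [set w | a (X w - Y w) < r]).
Proof.
move=> mD fD r0; have [x Hx] := local_field_separable hK.
pose C i := D `&` X @^-1` [set y | a (y - x i) < r].
have mC i : measurable (C i) by apply: measurableI => //; exact/mX/kopen_lt.
have /choice[H HP] : forall i, exists H, [/\ G H,
    (forall A, G A -> A `<=` ~` H -> P (A `&` C i) = 0) &
    (forall A, G A -> A `<=` H -> P (A `&` C i) = 0 -> P A = 0)].
  by move=> i; exact: conditional_hull (mC i).
have GH i : G (H i) by case: (HP i).
(* [F i] is the event that [i] is the first index with [H i]; off their union, [Y] defaults to
   [x 0]. *)
pose F := seqDU H.
have GF i : G (F i).
  rewrite /F /seqDU setDE; apply: sigma_algebra_setI => //.
  apply: sigma_algebra_setC => //; apply: big_ind => //; first by case: sG.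
  exact: sigma_algebra_setU.
have GcH : G (~` \bigcup_i H i).
  by apply: sigma_algebra_setC => //; exact: sigma_algebra_bigcupT.
pose Y w := x (xget 0%N [set i | F i w]).
have YF i w : F i w -> Y w = x i.
  move=> Fi; rewrite /Y; case: xgetP => [j _ /= Fj|/(_ i)//]; congr x.
  apply: contrapT => /eqP ij.
  have /trivIsetP /(_ _ _ I I ij) := trivIset_seqDU H.
  by move=> FF; have : set0 w by rewrite -FF.
have YcH w : ~ (\bigcup_i H i) w -> Y w = x 0%N.
  rewrite seqDU_bigcup_eq => nF; rewrite /Y; case: xgetP => // j _ /= Fj.
  by case: nF; exists j.
have GY : Kmeasurable a G Y.
  move=> U _.
  have -> : Y @^-1` U = (\bigcup_i (F i `&` [set w | U (x i)])) `|`
      ((~` \bigcup_i H i) `&` [set w | U (x 0%N)]).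
    apply/seteqP; split => [w /= UY|w [[i _ [Fi /= Ux]]|[nH /= Ux]]].
    - have [|nH] := pselect ((\bigcup_i H i) w).
        rewrite seqDU_bigcup_eq => -[i _ Fi]; left; exists i => //; split => //=.
        by rewrite -(YF i w).
      by right; split => //=; rewrite -(YcH w).
    - by rewrite (YF i w).
    - by rewrite YcH.
  have Gc := sigma_algebra_cst sG.
  apply: sigma_algebra_setU => //; last exact: sigma_algebra_setI.
  by apply: sigma_algebra_bigcupT => // i; exact: sigma_algebra_setI.
exists Y; split => // A GA PA0.
have mY := Kmeasurable_sub_sigma_field GY.
have mXY : measurable [set w | a (X w - Y w) < r] by exact: Kmeasurable_nabs_lt.
(* On [F i] the value of [Y] is [x i], so [C i] meets [A]&[F i] in a null set; as [F i] lies in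
   [H i], the hull property applies. *)
have PF i : P (A `&` F i) = 0.
  have [_ _ +] := HP i; apply; first exact: sigma_algebra_setI.
    by apply: subset_trans (@subIsetr _ _ _) _; exact: subset_seqDU.
  apply: null_subset PA0.
  - by apply: measurableI => //; apply: measurableI; exact: GM.
  - by apply: measurableI; [exact: GM|exact: measurableI].
  - by move=> w [[Aw Fw] [Dw /= Xw]]; split => //; split => //=; rewrite (YF i w).
pose E := A `&` ~` (\bigcup_i H i).
have GE : G E by exact: sigma_algebra_setI.
(* Off all the [H i] every [C i] is null, and by density the [C i] cover [D]; fullness of [D]
   concludes. *)
have PE : P E = 0.
  apply: fD => //; apply: measure_negligible.
    by apply: measurableI => //; exact: GM.
  apply: (@negligibleS _ _ _ _ (\bigcup_i (E `&` C i))).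
    move=> w [Ew Dw]; have [i Xi] := Hx (X w) _ r0.
    by exists i => //; split => //; split.
  apply: negligible_bigcup => i; exists (E `&` C i); split => //.
    by apply: measurableI => //; exact: GM.
  have [_ + _] := HP i; apply => // w [_ nH] Hw.
  by apply: nH; exists i.
apply: measure_negligible; first exact: GM.
apply: (@negligibleS _ _ _ _ (E `|` \bigcup_i (A `&` F i))).
  move=> w Aw; have [|nH] := pselect ((\bigcup_i H i) w); last by left.
  by rewrite seqDU_bigcup_eq => -[i _ Fi]; right; exists i.
apply: negligibleU; first by exists E; split => //; exact: GM.
apply: negligible_bigcup => i; exists (A `&` F i); split => //; last exact: PF.
by apply: measurableI; exact: GM.
Qed.

(** For open [U], let [V n] be the open set of points whose ball of radius [2^-1 ^+ n] lies in [U]: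
    [L] is in [U] exactly when some [z n] is in [V n]. *)
Lemma Kmeasurable_limit (z : nat -> T -> K) (L : T -> K) :
  (forall n, Kmeasurable a G (z n)) ->
  (forall n w, a (L w - z n w) < 2^-1 ^+ n) -> Kmeasurable a G L.
Proof.
move=> Gz zL U Uo.
pose V n := [set x | forall y, a (y - x) < 2^-1 ^+ n -> U y].
have Vo n : kopen a (V n).
  move=> x Vx; exists (2^-1 ^+ n); split; first by rewrite exprn_gt0.
  by move=> y yx y' y'y; apply: Vx; exact: nabs_lt_trans yx.
have -> : L @^-1` U = \bigcup_n (z n @^-1` V n).
  apply/seteqP; split => [w /= /Uo[r [r0 Ur]]|w [n _ /= Vw]]; last exact: Vw.
  have [n nr] := exists_half_expn_lt r0; exists n => // y yz; apply: Ur.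
  by apply: lt_trans nr; apply: nabs_lt_trans yz _; rewrite nabsC.
by apply: sigma_algebra_bigcupT => // n; exact/Gz/Vo.
Qed.

Lemma conditional_support_selection : exists Y, Kmeasurable a G Y /\
  forall e, 0 < e -> conditionally_full P G [set w | a (X w - Y w) < e].
Proof.
have h0 n : 0 < 2^-1 ^+ n :> R by rewrite exprn_gt0.
(* The hypotheses on the set are kept inside the choice, so that [F] is total and [D] can be defined
   by plain recursion. *)
have /choice[F HF] : forall Dn : set T * nat, exists Y, measurable Dn.1 ->
    conditionally_full P G Dn.1 -> Kmeasurable a G Y /\
    conditionally_full P G (Dn.1 `&` [set w | a (X w - Y w) < 2^-1 ^+ Dn.2]).
  move=> [D n] /=; have [mD|?] := pselect (measurable D); last by exists (fun=> 0).
  have [fD|?] := pselect (conditionally_full P G D); last by exists (fun=> 0).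
  by have [Y HY] := conditional_support_step mD fD (h0 n); exists Y.
pose D := fix D n := if n is m.+1 then
  D m `&` [set w | a (X w - F (D m, m) w) < 2^-1 ^+ m] else setT.
pose y n := F (D n, n).
have DP n : [/\ measurable (D n), conditionally_full P G (D n) & Kmeasurable a G (y n)].
  elim: n => [|n [mD fD Gy]].
    have f0 : conditionally_full P G (D 0%N) by move=> A _; rewrite setIT.
    have [Gy _] := HF (D 0%N, 0%N) measurableT f0.
    by split; [exact: measurableT|exact: f0|exact: Gy].
  have mD' : measurable (D n.+1).
    apply: measurableI => //; apply: (Kmeasurable_nabs_lt hK sM) => //.
    exact: Kmeasurable_sub_sigma_field.
  have fD' : conditionally_full P G (D n.+1) by have [] := HF (D n, n) mD fD.
  have [Gy' _] := HF (D n.+1, n.+1) mD' fD'.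
  by split; [exact: mD'|exact: fD'|exact: Gy'].
have Dy n w : D n.+1 w -> a (X w - y n w) < 2^-1 ^+ n by case.
pose W := \bigcap_n [set w | a (y n.+1 w - y n w) < 2^-1 ^+ n].
have GW n : G [set w | a (y n.+1 w - y n w) < 2^-1 ^+ n].
  by apply: (Kmeasurable_nabs_lt hK sG); [case: (DP n.+1)|case: (DP n)].
have GWT : G W by exact: sigma_algebra_bigcapT.
have PW : P.-negligible (~` W).
  rewrite /W setC_bigcap; apply: negligible_bigcup => n.
  set E := ~` _; have GE : G E by exact: sigma_algebra_setC.
  exists E; split => //; first exact: GM.
  (* On [D n.+2] both [y n] and [y n.+1] are close to [X], hence to each other; so this full event
     misses [E]. *)
  have [_ fD _] := DP n.+2; apply: fD => //.
  rewrite (_ : E `&` _ = set0) ?measure0//; apply/seteqP; split => // w [].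
  move=> /= Ew Dw; apply: Ew.
  have D1w : D n.+1 w by case: Dw.
  apply: (@nabs_lt_trans _ _ _ (X w)); last exact: (Dy n).
  rewrite nabsC; apply: lt_le_trans (Dy n.+1 w Dw) _.
  by rewrite ler_wiXn2l// invf_le1// ler1n.
(* Resetting to 0 off [W] makes the sequence Cauchy at every point, not just almost surely. *)
pose z n w := if pselect (W w) then y n w else 0.
have /choice[L HL] : forall w, exists l, forall n, a (l - z n w) < 2^-1 ^+ n.
  move=> w; apply: local_field_complete => // n; rewrite /z.
  by case: pselect => [Ww|?]; [exact: (Ww n I)|rewrite subrr nabs0].
have Gz n : Kmeasurable a G (z n).
  move=> U Uo; have [_ _ Gy] := DP n.
  have -> : z n @^-1` U = (W `&` y n @^-1` U) `|` (~` W `&` [set w | U 0]).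
    apply/seteqP; split => w /=; rewrite /z; case: pselect => Ww; rewrite /=.
    - by left.
    - by right.
    - by case=> -[].
    - by case=> -[].
  have Gc := sigma_algebra_cst sG.
  apply: sigma_algebra_setU => //; apply: sigma_algebra_setI => //; first exact: Gy.
  exact: sigma_algebra_setC.
have GL : Kmeasurable a G L by apply: (Kmeasurable_limit Gz) => n w; exact: HL.
exists L; split => // e e0 A GA PA0.
have [n ne] := exists_half_expn_lt e0.
(* Up to the null complement of [W], the full event [D n.+1] lies in the event that [X] is within
   [e] of [L]. *)
have [mD fD _] := DP n.+1; apply: fD => //.
have mA := GM GA.
apply: measure_negligible; first exact: measurableI.
apply: (@negligibleS _ _ _ _ ((A `&` [set w | a (X w - L w) < e]) `|` ~` W)).
  move=> w [Aw Dw]; have [Ww|nW] := pselect (W w); last by right.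
  left; split => //=; apply: lt_trans ne; apply: nabs_lt_trans (Dy n w Dw) _.
  rewrite nabsC; have := HL w n; rewrite /z.
  by case: pselect.
apply: negligibleU => //; exists (A `&` [set w | a (X w - L w) < e]); split => //.
apply: measurableI => //; apply: (Kmeasurable_nabs_lt hK sM) => //.
exact: Kmeasurable_sub_sigma_field.
Qed.

End conditional_support.

(** * Measurability and boundedness of the distance of two maps *)

Section nabs_sub.
Context (K : fieldType) (R : realType) (a : nonarch_abs K R) (hK : local_field a).
Context d (T : measurableType d) (P : probability T R).

Lemma measurable_fun_nabsB (X Y : T -> K) : Kmeasurable a measurable X ->
  Kmeasurable a measurable Y -> measurable_fun setT (fun w => a (X w - Y w)).
Proof.
move=> mX mY; apply: (measurability _ (RGenInftyO.measurableE R)).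
move=> _ [_ [r ->] <-]; rewrite setTI.
rewrite (_ : _ @^-1` _ = [set w | a (X w - Y w) < r]).
  exact: (Kmeasurable_nabs_lt hK (sigma_algebra_measurable T)).
by apply/seteqP; split => w /=; rewrite in_itv.
Qed.

Lemma ae_bounded_nabsB (X Y : T -> K) :
  (exists M, {ae P, forall w, a (X w) <= M}) ->
  (exists M, {ae P, forall w, a (Y w) <= M}) ->
  exists M, {ae P, forall w, a (X w - Y w) <= M}.
Proof.
move=> [M XM] [N YN]; exists (Num.max M N); apply: filterS2 XM YN => w XM YN.
apply: le_trans (nabs_ultra _ _ _) _; rewrite nabsN ge_max !le_max XM YN.
by rewrite orbT.
Qed.

End nabs_sub.

(** * Optimality of the selection from the conditional support *)

Theorem mainTheorem9 (K : fieldType) (R : realType) (a : nonarch_abs K R)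
  (hK : local_field a)
  (d : measure_display) (T : measurableType d) (P : probability T R)
  (X : T -> K) (hX : Linf a P measurable X)
  (G : set (set T)) (hG : sub_sigma_field G) :
  exists Y : T -> K, in_cond_exp a P G X Y.
Proof.
case: (hX) => mX bX; case: (hG) => sG GM.
have [Y [GY fY]] := conditional_support_selection hK P hG mX.
have mY := Kmeasurable_sub_sigma_field hG GY.
(* On the [G]-event [B] where [A] holds but [a (Z w - Y w) > q], having [X] within [q] of [Y] would
   contradict the bound on [X - Z]; so that event is null within [B], and fullness makes [B]
   null. *)
have key (Z : T -> K) (A : set T) q : 0 < q -> Kmeasurable a G Z -> G A ->
    {ae P, forall w, A w -> a (X w - Z w) <= q} ->
    {ae P, forall w, A w -> a (Z w - Y w) <= q}.
  move=> q0 GZ GA XZ; pose B := A `&` ~` [set w | a (Z w - Y w) <= q].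
  have GB : G B.
    apply: sigma_algebra_setI => //; apply: sigma_algebra_setC => //.
    exact: Kmeasurable_nabs_le.
  exists B; split; first exact: GM.
    apply: (fY q q0) => //; apply: measure_negligible.
      apply: measurableI; first exact: GM.
      exact: (Kmeasurable_nabs_lt hK (sigma_algebra_measurable T)).
    apply: negligibleS XZ => w [[Aw Bw] /= /ltW XY] /(_ Aw) XZw; apply: Bw => /=.
    by apply: nabs_le_trans XY; rewrite nabsC.
  by move=> w /= /not_implyP.
have bY : exists M, {ae P, forall w, a (Y w) <= M}.
  (* Boundedness of [Y] is [key] with [Z = 0] on the whole space; the maximum with 1 makes the
     radius positive. *)
  case: bX => M XM; exists (Num.max M 1).
  have G0 : Kmeasurable a G (fun=> 0) by move=> U _; exact: (sigma_algebra_cst sG (U 0)).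
  have M0 : 0 < Num.max M 1 by rewrite lt_max ltr01 orbT.
  have := key (fun=> 0) setT _ M0 G0 (sigma_algebra_setT sG).
  have H : {ae P, forall w, setT w -> a (X w - 0) <= Num.max M 1}.
    by apply: filterS XM => w XM _; rewrite subr0 le_max XM.
  by move=> /(_ H); apply: filterS => w /(_ I); rewrite sub0r nabsN.
exists Y; split => // Z [GZ bZ].
have mZ := Kmeasurable_sub_sigma_field hG GZ.
have mXZ := measurable_fun_nabsB hK mX mZ.
have bXZ := ae_bounded_nabsB bX bZ.
(* Minimality is applied with the conditional norm of [X - Z] as [V]: where it is at most [q], both
   [X - Z] and, by [key], [Z - Y] are bounded by [q]. *)
rewrite /normG; apply: cond_esssup_ae_le => //.
- by move=> w; exact: nabs_ge0.
- exact: measurable_fun_nabsB.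
- exact: ae_bounded_nabsB.
- by move=> w; exact: cond_esssup_ge0.
- by move=> q q0; apply: cond_esssup_measurable => // w; exact: nabs_ge0.
- move=> q q0.
  have XZ := ae_le_cond_esssup hG (fun w => nabs_ge0 a _) mXZ bXZ (ltW q0).
  have GA := cond_esssup_measurable hG (fun w => nabs_ge0 a _) mXZ bXZ q.
  apply: filterS2 XZ (key Z _ q q0 GZ GA XZ) => w XZ ZY Vq.
  exact: nabs_le_trans (XZ Vq) (ZY Vq).
Qed.
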